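(* Let $n,d\ge 1$ and let $H_1,\ldots,H_n$ be an arrangement of tropical hyperplanes in $\mathbb{TP}^{d-1}$, where $H_i$ has apex $v_i=(v_{i1},\ldots,v_{id})$. Then the collection of types of all points $x\in\mathbb{TP}^{d-1}$ with respect to this arrangement is a tropical oriented matroid with parameters $(n,d)$.
   Context: Write $[d]=\{1,\ldots,d\}$. Tropical projective space is $\mathbb{TP}^{d-1}=\mathbb{R}^d/(1,\ldots,1)\mathbb{R}$. For $c\in\mathbb{R}^d$, the tropical hyperplane given by the linear functional $\bigoplus c_i\odot x_i$ is the set of $x\in\mathbb{TP}^{d-1}$ for which $\max(c_1+x_1,\ldots,c_d+x_d)$ is attained at least twice; its apex is $(-c_1,\ldots,-c_d)$. Given an arrangement of tropical hyperplanes with apexes $v_1,\ldots,v_n$, the type of a point $x\in\mathbb{TP}^{d-1}$ is the $n$-tuple $(A_1,\ldots,A_n)$ where $A_i\subseteq[d]$ is the set of indices $j$ for which $x_j-v_{ij}$ is maximal. An $(n,d)$-type is an $n$-tuple $(A_1,\ldots,A_n)$ of nonempty subsets of $[d]$. Comparability graph: given two $(n,d)$-types $A$ and $B$, the comparability graph $CG_{A,B}$ has vertex set $[d]$; for each $1\le i\le n$, and each $j\in A_i$, $k\in B_i$, draw an edge between $j$ and $k$, which is undirected if $j,k\in A_i\cap B_i$ and directed $j\to k$ otherwise (multiple edges are allowed). A directed path from $a$ to $b$ in such a graph with directed and undirected edges is a sequence of vertices $w_0=a,w_1,\ldots,w_k=b$ and edges $e_1,\ldots,e_k$, at least one of which is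 directed, such that each $e_i$ is either a directed edge from $w_{i-1}$ to $w_i$ or an undirected edge joining them. A directed cycle is a directed path with identical endpoints; the graph is acyclic if it has no directed cycle. Refinement: the refinement of an $(n,d)$-type $A=(A_1,\ldots,A_n)$ with respect to an ordered partition $(P_1,\ldots,P_r)$ of $[d]$ is $B=(A_1\cap P_{m(1)},\ldots,A_n\cap P_{m(n)})$, where $m(i)$ is the largest index for which $A_i\cap P_{m(i)}$ is nonempty. A tropical oriented matroid $M$ with parameters $(n,d)$ is a collection of $(n,d)$-types satisfying: (Boundary) for each $j\in[d]$, the type $(j,j,\ldots,j)$ (every coordinate equal to the singleton $\{j\}$) is in $M$; (Elimination) for any $A,B\in M$ and any position $j\in[n]$ there is $C\in M$ with $C_j=A_j\cup B_j$ and $C_k\in\{A_k,B_k,A_k\cup B_k\}$ for all $k\in[n]$; (Comparability) for any $A,B\in M$ the comparability graph $CG_{A,B}$ is acyclic; (Surrounding) if $A\in M$, then every refinement of $A$ is in $M$. *)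

(* Defs.v *)
From mathcomp Require Import all_boot all_order all_algebra generic_quotient.
From mathcomp Require Import boolp classical_sets reals.
Set Implicit Arguments.
Unset Strict Implicit.
Unset Printing Implicit Defensive.
Import Order.TTheory GRing.Theory Num.Theory.
Local Open Scope ring_scope.
Local Open Scope quotient_scope.
Local Open Scope set_scope.

(* The index sets [n] and [d] are 'I_n and 'I_d, i.e. indices start at 0. *)

Section TropicalProjectiveSpace.
Variables (R : realType) (d : nat).
Implicit Types (x y c : 'rV[R]_d) (f g : 'I_d -> R).

Definition tp_equiv x y : bool := `[< exists t : R, x = y + const_mx t >].

Lemma tp_equiv_refl : reflexive tp_equiv.
Proof. by move=> x; apply/asboolP; exists 0; rewrite raddf0 addr0. Qed.

Lemma tp_equiv_sym : symmetric tp_equiv.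
Proof.
suff imp x y : tp_equiv x y -> tp_equiv y x by move=> x y; apply/idP/idP; apply: imp.
move=> /asboolP[t ->]; apply/asboolP; exists (- t).
by rewrite raddfN addrK.
Qed.

Lemma tp_equiv_trans : transitive tp_equiv.
Proof.
move=> y x z /asboolP[s ->] /asboolP[t ->]; apply/asboolP; exists (t + s).
by rewrite raddfD addrA.
Qed.

Canonical tp_equivrel :=
  EquivRel tp_equiv tp_equiv_refl tp_equiv_sym tp_equiv_trans.

(* TP^{d-1} = R^d / R(1,...,1); the parameter is d, not the dimension. *)
Definition TP := {eq_quot tp_equivrel}.

Definition argmax f : {set 'I_d} := [set j | [forall k, f k <= f j]].

Lemma argmax_shift t f g : (forall j, f j = g j + t) -> argmax f = argmax g.
Proof.
by move=> fg; apply/setP => j; rewrite !inE; apply: eq_forallb => k; rewrite !fg lerD2r.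
Qed.

Lemma repr_pi_shift x : exists t, repr (\pi_TP x) = x + const_mx t.
Proof. by apply/asboolP; have /eqmodP := reprK (\pi_TP x). Qed.

Definition tropical_hyperplane c : set TP :=
  fun p => (1 < #|argmax (fun j => (c 0 j + repr p 0 j)%R)|)%N.

Lemma tropical_hyperplane_pi c x :
  tropical_hyperplane c (\pi x) =
  (1 < #|argmax (fun j => (c 0 j + x 0 j)%R)|)%N :> Prop.
Proof.
rewrite /tropical_hyperplane; have [t ->] := repr_pi_shift x.
by rewrite (@argmax_shift t _ (fun j => c 0 j + x 0 j)) // => j; rewrite !mxE addrA.
Qed.

Definition apex c : 'rV[R]_d := - c.

Definition tropical_hyperplane_with_apex (H : set TP) (v : 'rV[R]_d) : Prop :=
  exists2 c, H = tropical_hyperplane c & v = apex c.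

End TropicalProjectiveSpace.

(* An n-tuple of subsets of [d]; it is an (n,d)-type when is_ndtype holds. *)
Notation set_tuple n d := {ffun 'I_n -> {set 'I_d}}.

Definition is_ndtype n d (A : set_tuple n d) : Prop :=
  forall i, A i != finset.set0.

Definition point_type (R : realType) n d (v : 'I_n -> 'rV[R]_d) (p : TP R d) :
    set_tuple n d :=
  [ffun i => argmax (fun j => (repr p 0 j - v i 0 j)%R)].

Lemma point_type_pi (R : realType) n d (v : 'I_n -> 'rV[R]_d) (x : 'rV[R]_d) :
  point_type v (\pi x) = [ffun i => argmax (fun j => (x 0 j - v i 0 j)%R)].
Proof.
apply/ffunP => i; rewrite !ffunE; have [t ->] := repr_pi_shift x.
by apply: (@argmax_shift _ _ t) => j; rewrite !mxE addrAC.
Qed.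

Definition arrangement_types (R : realType) n d (v : 'I_n -> 'rV[R]_d) :
    set (set_tuple n d) :=
  range (point_type v).

(* Multigraphs with directed and undirected edges; the orientation of e given
   by (tail e, head e) is only significant when e is directed. *)
Record mixed_multigraph (V E : finType) := MixedMultigraph {
  edges : {set E};
  tail : E -> V;
  head : E -> V;
  directed : pred E
}.

Section MixedMultigraph.
Variables (V E : finType) (G : mixed_multigraph V E).

Definition traverses (e : E) (u w : V) : bool :=
  (e \in edges G) &&
  ((tail G e == u) && (head G e == w)
   || [&& ~~ directed G e, tail G e == w & head G e == u]).

(* The step (e_i, w_i) goes along the edge e_i from w_{i-1} to w_i. *)
Fixpoint walk (a : V) (s : seq (E * V)) (b : V) : bool :=
  if s is (e, w) :: s' then traverses e a w && walk w s' b else a == b.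

Definition directed_path (a : V) (s : seq (E * V)) (b : V) : bool :=
  walk a s b && has (fun ew => directed G ew.1) s.

Definition acyclic : Prop := forall a s, ~~ directed_path a s a.

End MixedMultigraph.

(* The edge (i, j, k) is the one drawn for j in A_i and k in B_i. *)
Definition comparability_graph n d (A B : set_tuple n d) :
    mixed_multigraph 'I_d ('I_n * 'I_d * 'I_d)%type :=
  {| edges := [set e | (e.1.2 \in A e.1.1) && (e.2 \in B e.1.1)];
     tail := fun e => e.1.2;
     head := fun e => e.2;
     directed := fun e => ~~ ((e.1.2 \in A e.1.1 :&: B e.1.1)
                              && (e.2 \in A e.1.1 :&: B e.1.1)) |}.

Definition ordered_partition d (P : seq {set 'I_d}) : Prop :=
  uniq P /\ finset.partition [set:: P] [set: 'I_d].

Definition refinement n d (A : set_tuple n d) (P : seq {set 'I_d}) :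
    set_tuple n d :=
  [ffun i => A i :&:
     nth finset.set0 P (\max_(m < size P | A i :&: nth finset.set0 P m != finset.set0) m)%N].

Record tropical_oriented_matroid n d (M : set (set_tuple n d)) : Prop := {
  tom_types : forall A, M A -> is_ndtype A;
  tom_boundary : forall j : 'I_d, M [ffun=> [set j]];
  tom_elimination : forall A B (j : 'I_n), M A -> M B ->
    exists C, [/\ M C, C j = A j :|: B j &
                  forall k, C k \in [:: A k; B k; A k :|: B k]];
  tom_comparability : forall A B, M A -> M B ->
    acyclic (comparability_graph A B);
  tom_surrounding : forall A P, M A -> ordered_partition P ->
    M (refinement A P)
}.

(* Main.v *)
Require Import Defs.
From mathcomp Require Import all_boot all_order all_algebra.
From mathcomp Require Import classical_sets reals.
From mathcomp Require Import boolp ring lra.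
Set Implicit Arguments.
Unset Strict Implicit.
Unset Printing Implicit Defensive.

(** The type of a point [x] lists, for each apex [v i], the argmax set of
    the function [x - v i], so each axiom becomes a statement about how argmax
    sets react to an operation on [x].
    - Elimination: lift the two points to vectors [x] and [y] in such a way
      that [x - v j] and [y - v j] have the same maximum, and take the
      coordinatewise maximum of [x] and [y]. The argmax set of the maximum of
      two functions is that of the function with the larger maximum, or the
      union of both when the maxima agree ([argmax_max]).
    - Surrounding: replace [x] by [x + e * h], where [h] numbers the blocks of
      the ordered partition and [e] is small and positive. Such a perturbation
      selects in every argmax set the elements where [h] is largest
      ([argmax_perturb]), which is what a refinement does
      ([refinement_block_index]).
    - Boundary: the same perturbation argument near infinity. Far out in the
      direction of the [j]-th unit vector, that vector is the dominant term and
      the apexes are the perturbation.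
    - Comparability: along every edge of the comparability graph of the types
      of [x] and [y] the function [y - x] does not decrease, and it increases
      strictly if the edge is directed ([traverses_potential]). A potential of
      this kind excludes directed cycles. *)

Import Order.TTheory GRing.Theory Num.Theory.
Local Open Scope ring_scope.
Local Open Scope quotient_scope.

(** * Argmax sets *)

Section Argmax.
Variables (R : realType) (d : nat).
Implicit Types (f g h : 'I_d -> R).

Lemma argmaxP f j : reflect (forall k, f k <= f j) (j \in argmax f).
Proof. by rewrite inE; apply: forallP. Qed.

Lemma mem_argmax f a j : a \in argmax f -> (j \in argmax f) = (f a <= f j).
Proof.
move=> /argmaxP fa; apply/argmaxP/idP => [|le_aj k]; first exact.
exact: le_trans (fa k) le_aj.
Qed.

Lemma argmax_exists f : (0 < d)%N -> exists a, a \in argmax f.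
Proof.
move=> d0; exists [arg max_(j > Ordinal d0) f j]%O.
by apply/argmaxP => k; case: arg_maxP => // j _; apply.
Qed.

Lemma argmax_scale (t : R) f : 0 < t -> argmax (fun j => t * f j) = argmax f.
Proof.
move=> t0; apply/setP => j; rewrite !inE.
by apply: eq_forallb => k; rewrite ler_pM2l.
Qed.

Lemma argmax_max f g a b : a \in argmax f -> b \in argmax g ->
  argmax (fun j => Num.max (f j) (g j)) =
    if f a < g b then argmax g
    else if g b < f a then argmax f else argmax f :|: argmax g.
Proof.
(* By symmetry the overall maximum may be assumed to be [g b]. *)
wlog le_ab : f g a b / f a <= g b => [sym fa gb|fa gb].
  have [le_ab|le_ba] := orP (le_total (f a) (g b)); first exact: sym.
  rewrite (_ : (fun j => _) = (fun j => Num.max (g j) (f j))); last first.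
    by apply/funext => j; rewrite maxC.
  by rewrite (sym g f b a) // finset.setUC; case: ltgtP.
have fP := argmaxP _ _ fa; have gP := argmaxP _ _ gb.
have maxb : b \in argmax (fun j => Num.max (f j) (g j)).
  apply/argmaxP => k; rewrite le_max !ge_max gP (le_trans (fP k) le_ab).
  by rewrite orbT.
apply/setP => j; rewrite (mem_argmax j maxb) /=.
rewrite (max_r (le_trans (fP b) le_ab)) le_max -(mem_argmax j gb).
case: ltgtP le_ab => // [lt_ab _|eq_ab _].
  by rewrite leNgt (le_lt_trans (fP j) lt_ab).
by rewrite finset.in_setU (mem_argmax j fa) eq_ab.
Qed.

Lemma exists_small (I : finType) (P : pred I) (g : I -> R) :
  (forall i, P i -> 0 < g i) -> exists2 e, 0 < e & forall i, P i -> e <= g i.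
Proof.
move=> g0; exists (\big[Num.min/1]_(i | P i) g i).
  by apply/bigmin_gtP; split.
by move=> i Pi; apply: bigmin_le_cond.
Qed.

(** A perturbation smaller than every gap between different values of [f i]
    cannot bring a new index into the argmax set; it only breaks the ties
    among the old ones. As there are finitely many gaps, one [e] serves a
    finite family of functions. *)
Lemma argmax_perturb (I : finType) (f h : I -> 'I_d -> R) :
  exists2 e, 0 < e & forall i, argmax (fun j => f i j + e * h i j) =
    [set j in argmax (f i) | [forall k in argmax (f i), h i k <= h i j]].
Proof.
pose gap (u : I * 'I_d * 'I_d) := f u.1.1 u.2 - f u.1.1 u.1.2.
pose slope (u : I * 'I_d * 'I_d) := 1 + `|h u.1.1 u.1.2 - h u.1.1 u.2|.
have slope0 u : 0 < slope u by rewrite ltr_pwDl.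
have [|e e0 small] := @exists_small _ (fun u => 0 < gap u)
  (fun u => gap u / slope u).
  by move=> u gap0; rewrite divr_gt0.
have dom i k j : f i k < f i j -> f i k + e * h i k < f i j + e * h i j.
  move=> lt_kj; have := small (i, k, j); rewrite /gap subr_gt0 => /(_ lt_kj).
  rewrite ler_pdivlMr // /slope /= => le_gap.
  have := ler_norm (h i k - h i j); rewrite -(ler_pM2l e0) => le_h.
  by rewrite -subr_gt0; lra.
exists e => // i; apply/setP => j; rewrite inE; apply/idP/andP.
  move=> /argmaxP jmax.
  have fj : j \in argmax (f i).
    by apply/argmaxP => k; rewrite leNgt; apply/negP => /dom; rewrite ltNge jmax.
  split=> //; apply/forall_inP => k fk; have := jmax k.
  rewrite (@le_anti _ _ (f i k) (f i j)) ?lerD2l ?ler_pM2l //.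
  by rewrite (argmaxP _ _ fj) (argmaxP _ _ fk).
move=> [fj /forall_inP hj]; apply/argmaxP => k.
have [fk|] := boolP (k \in argmax (f i)).
  by rewrite lerD ?(argmaxP _ _ fj) // ler_pM2l // hj.
by rewrite (mem_argmax k fj) -ltNge => /dom/ltW.
Qed.

End Argmax.

(** * Types of points given by vectors *)

Lemma arrangement_typesP (R : realType) n d (v : 'I_n -> 'rV[R]_d)
    (A : set_tuple n d) :
  arrangement_types v A <->
  exists x : 'rV[R]_d, A = [ffun i => argmax (fun j => x 0 j - v i 0 j)].
Proof.
split=> [[p _ <-]|[x ->]]; first by exists (repr p).
by exists (\pi x) => //; rewrite point_type_pi.
Qed.

(** * Refinements *)

Section Refinement.
Variables (d : nat) (P : seq {set 'I_d}).
Hypothesis partP : ordered_partition P.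

Definition block_index (j : 'I_d) : nat := index (finset.pblock [set:: P] j) P.

Lemma pblock_mem_seq j : finset.pblock [set:: P] j \in P.
Proof.
case: partP => _ /and3P[/eqP covP _ _].
by have := @finset.pblock_mem _ [set:: P] j; rewrite covP !inE; apply.
Qed.

Lemma block_index_lt j : (block_index j < size P)%N.
Proof. by rewrite index_mem pblock_mem_seq. Qed.

Lemma mem_block j m : (m < size P)%N ->
  (j \in nth finset.set0 P m) = (block_index j == m).
Proof.
case: (partP) => uP /and3P[/eqP covP tP _] ltm; apply/idP/eqP => [jm|<-].
  rewrite /block_index (finset.def_pblock tP _ jm) ?index_uniq //.
  by rewrite inE mem_nth.
by rewrite nth_index ?pblock_mem_seq // finset.mem_pblock covP inE.
Qed.

(** The last block that meets [A i] is the one whose number is the maximum of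
    [block_index] on [A i]; refining thus breaks ties by [block_index], in the
    form produced by [argmax_perturb]. *)
Lemma refinement_block_index n (A : set_tuple n d) i : A i != finset.set0 ->
  refinement A P i =
    [set j in A i | [forall k in A i, block_index k <= block_index j]%N].
Proof.
move=> /set0Pn[a0 Aa0]; rewrite ffunE.
case: (arg_maxnP block_index Aa0) => a Aa geq_a.
have amax k : k \in A i -> (block_index k <= block_index a)%N by apply: geq_a.
have -> : (\max_(m < size P | A i :&: nth finset.set0 P m != finset.set0) m =
           block_index a)%N.
  apply/eqP; rewrite eqn_leq; apply/andP; split.
    apply/bigmax_leqP => m /set0Pn[k]; rewrite inE mem_block //.
    by move=> /andP[Ak /eqP <-]; apply: amax.
  apply: (@leq_bigmax_cond _ _ (fun m : 'I_(size P) => m : nat)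
    (Ordinal (block_index_lt a))).
  by apply/set0Pn; exists a; rewrite inE [a \in A i]Aa mem_block ?block_index_lt /=.
apply/setP => j; rewrite !inE mem_block ?block_index_lt //.
have [Aj|//] := boolP (j \in A i); apply/eqP/forall_inP => /= [-> k|jmax].
  exact: amax.
by apply/eqP; rewrite eqn_leq amax //= jmax.
Qed.

End Refinement.

(** * Potentials on the comparability graph *)

(** A function that does not decrease along edges and increases along directed
    edges has a strictly larger value at the end of a directed path than at
    its start. *)
Lemma acyclic_potential (R : realType) (V E : finType)
    (G : mixed_multigraph V E) (phi : V -> R) :
  (forall e u w, traverses G e u w ->
     phi u <= phi w /\ (directed G e -> phi u < phi w)) ->
  acyclic G.
Proof.
move=> pot; have walk_le a s b : walk G a s b -> phi a <= phi b.
  elim: s a => [|[e w] s IHs] a /=; first by move=> /eqP->.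
  by move=> /andP[/pot[le_aw _] /IHs]; apply: le_trans.
have path_lt a s b : directed_path G a s b -> phi a < phi b.
  rewrite /directed_path; elim: s a => [|[e w] s IHs] a /=.
    by rewrite andbF.
  move=> /andP[/andP[/pot[le_aw lt_aw] wb] /orP[/lt_aw lt|dir]].
    exact: lt_le_trans lt (walk_le _ _ _ wb).
  by apply: le_lt_trans le_aw (IHs _ _); rewrite wb.
by move=> a s; apply/negP => /path_lt; rewrite ltxx.
Qed.

(** If [u] maximizes [x - v i] and [w] maximizes [y - v i], then
    [x u - x w >= v i u - v i w >= y u - y w]. Equality holds throughout exactly
    when [u] and [w] both maximize both functions, that is, when the edge is
    undirected. *)
Lemma traverses_potential (R : realType) n d (v : 'I_n -> 'rV[R]_d)
    (x y : 'rV[R]_d) e u w :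
  let A := [ffun i => argmax (fun j => x 0 j - v i 0 j)] in
  let B := [ffun i => argmax (fun j => y 0 j - v i 0 j)] in
  traverses (comparability_graph A B) e u w ->
  y 0 u - x 0 u <= y 0 w - x 0 w /\
  (directed (comparability_graph A B) e -> y 0 u - x 0 u < y 0 w - x 0 w).
Proof.
case: e => -[i j] k A B; rewrite /traverses finset.in_set /= !finset.in_setI /A /B !ffunE.
move=> /andP[/andP[jA kB]].
rewrite jA kB (mem_argmax k jA) (mem_argmax j kB) /= andbT.
have := argmaxP _ _ jA k; have := argmaxP _ _ kB j => /= le_y le_x.
case/orP => [/andP[/eqP<- /eqP<-]|/and3P[]].
  split; first by lra.
  by rewrite negb_and -!ltNge => /orP[] ?; lra.
rewrite negbK => /andP[ge_y ge_x] /eqP<- /eqP<-.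
by split; [lra|rewrite ge_y ge_x].
Qed.

(** * The properties of an arrangement *)

Section Arrangement.
Variables (R : realType) (n d : nat) (v : 'I_n -> 'rV[R]_d).

Lemma arrangement_boundary (j : 'I_d) : arrangement_types v [ffun=> [set j]].
Proof.
apply/arrangement_typesP.
have [e e0 eP] := argmax_perturb
  (fun (i : 'I_n) k => (k == j)%:R : R) (fun i k => - v i 0 k).
exists (\row_k (e^-1 * (k == j)%:R)); apply/ffunP => i; rewrite !ffunE.
(* Scaling by [e] turns the apex into a perturbation of the unit vector. *)
have -> : (fun k => (\row_k' (e^-1 * (k' == j)%:R)) 0 k - v i 0 k) =
          (fun k => e^-1 * ((k == j)%:R + e * - v i 0 k)).
  by apply/funext => k; rewrite mxE mulrDr mulKf ?(gt_eqF e0).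
rewrite argmax_scale ?invr_gt0 // eP.
have -> : argmax (fun k => (k == j)%:R : R) = [set j].
  have jmax : j \in argmax (fun k => (k == j)%:R : R).
    by apply/argmaxP => k; rewrite eqxx lern1 leq_b1.
  by apply/setP => k; rewrite (mem_argmax k jmax) eqxx inE ler1n lt0b.
apply/setP => k; rewrite !inE; case: eqP => //= ->; apply/esym/forall_inP.
by move=> l; rewrite inE => /eqP->.
Qed.

Lemma arrangement_elimination A B (j : 'I_n) : (0 < d)%N ->
  arrangement_types v A -> arrangement_types v B ->
  exists C, [/\ arrangement_types v C, C j = A j :|: B j &
                forall k, C k \in [:: A k; B k; A k :|: B k]].
Proof.
move=> d0 /arrangement_typesP[x ->] /arrangement_typesP[y0 ->].
have [a amax] := argmax_exists (fun k => x 0 k - v j 0 k) d0.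
have [b bmax] := argmax_exists (fun k => y0 0 k - v j 0 k) d0.
(* Another representative of the second point, chosen so that the maxima at
   position [j] agree. *)
pose t := (x 0 a - v j 0 a) - (y0 0 b - v j 0 b).
pose y := y0 + const_mx t.
have yE i : argmax (fun k => y0 0 k - v i 0 k) =
            argmax (fun k => y 0 k - v i 0 k).
  by apply/esym; apply: (@argmax_shift _ _ t) => k; rewrite !mxE addrAC.
pose z := \row_k Num.max (x 0 k) (y 0 k).
have zE i : argmax (fun k => z 0 k - v i 0 k) =
    argmax (fun k => Num.max (x 0 k - v i 0 k) (y 0 k - v i 0 k)).
  by congr argmax; apply/funext => k; rewrite mxE addr_maxl.
exists [ffun i => argmax (fun k => z 0 k - v i 0 k)].
split; first by apply/arrangement_typesP; exists z.
  rewrite !ffunE zE yE; rewrite yE in bmax.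
  rewrite (argmax_max amax bmax).
  have -> : y 0 b - v j 0 b = x 0 a - v j 0 a by rewrite !mxE /t; ring.
  by rewrite ltxx.
move=> k; rewrite !ffunE zE yE.
have [a' a'max] := argmax_exists (fun l => x 0 l - v k 0 l) d0.
have [b' b'max] := argmax_exists (fun l => y 0 l - v k 0 l) d0.
rewrite (argmax_max a'max b'max) !inE.
by case: ifP => _; [|case: ifP => _]; rewrite eqxx ?orbT.
Qed.

Lemma arrangement_comparability A B :
  arrangement_types v A -> arrangement_types v B ->
  acyclic (comparability_graph A B).
Proof.
move=> /arrangement_typesP[x ->] /arrangement_typesP[y ->].
apply: (@acyclic_potential _ _ _ _ (fun k => y 0 k - x 0 k)) => e u w.
exact: traverses_potential.
Qed.

Lemma arrangement_surrounding A P : (0 < d)%N ->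
  arrangement_types v A -> ordered_partition P ->
  arrangement_types v (refinement A P).
Proof.
move=> d0 /arrangement_typesP[x ->] partP; apply/arrangement_typesP.
have [e e0 eP] := argmax_perturb (fun i k => x 0 k - v i 0 k)
  (fun (i : 'I_n) k => (block_index P k)%:R).
exists (\row_k (x 0 k + e * (block_index P k)%:R)).
apply/ffunP => i; rewrite refinement_block_index //; last first.
  by rewrite ffunE; apply/set0Pn; apply: argmax_exists.
rewrite !ffunE.
have -> : (fun k => (\row_l (x 0 l + e * (block_index P l)%:R)) 0 k - v i 0 k) =
          (fun k => x 0 k - v i 0 k + e * (block_index P k)%:R).
  by apply/funext => k; rewrite mxE addrAC.
rewrite eP; apply/setP => j; rewrite !finset.in_set; congr (_ && _).
by apply: eq_forallb => k; rewrite ler_nat.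
Qed.

End Arrangement.

Local Close Scope quotient_scope.
Local Close Scope ring_scope.

Theorem theorem3p6 (R : realType) (n d : nat) (hn : 0 < n) (hd : 0 < d)
  (H : 'I_n -> set (TP R d)) (v : 'I_n -> 'rV[R]_d)
  (hH : forall i, tropical_hyperplane_with_apex (H i) (v i)) :
  tropical_oriented_matroid (arrangement_types v).
Proof.
split.
- move=> A /arrangement_typesP[x ->] i; rewrite ffunE; apply/set0Pn.
  exact: argmax_exists.
- exact: arrangement_boundary.
- by move=> A B j; apply: arrangement_elimination.
- exact: arrangement_comparability.
- by move=> A P; apply: arrangement_surrounding.
Qed.
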